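(* Let $a,b,c,d,e,f,n$ be complex parameters and let $$F(n,k,a):=\frac{(a)_{k+f}\,(b)_{k+e}}{(n+a)_{k+d}\,(n)_{k+c}},\qquad \mathfrak f(n,a):=\sum_{k=0}^{\infty}F(n,k,a),$$ and let $g_5,g_6$ be the associated functions defined in the context. Suppose that the standing assumptions (i)--(iv) listed in the context hold. Then the acceleration identity (of iteration pattern $(1,1)$) $$\mathfrak f(n,a)=\sum_{j=0}^{\infty}\left(\prod_{i=0}^{j-1}g_6(n+i,a+i)\right)g_5(n+j,a+j)$$ holds.
   Context: Rising factorials with arbitrary index are $(x)_y=\Gamma(x+y)/\Gamma(x)$; an empty product is $1$. The parameters $b,c,d,e,f$ are fixed throughout, while $n$ and $a$ are shifted by integers. Put $A=a+f$, $B=b+e$, $C=n+c$, $D=n+a+d$, $s=A+B-C-D=b-c-d+e+f-2n$ (all functions of $(n,a)$), and define $$p_1(n,a)=(D-A)(A-C)(C-B)(D-B)=(d-f+n)(a-c+f-n)(-b+c-e+n)(a-b+d-e+n),$$ $$p_2(n,a)=n(a+n)\,s\,(s+1),\qquad R(n,k,a)=n(a+n)\big(sk+s(C+D-1)-AB+CD\big),$$ $$p_3(n,a)=a(b-d+e-n-a),\qquad p_4(n,a)=(n+a)(-c+f-n+a+1),\qquad \mathcal R(n,k,a)=(n+a)(c+k+n-1),$$ $$G(n,k,a)=R(n,k,a)F(n,k,a),\qquad \mathcal G(n,k,a)=\mathcal R(n,k,a)F(n,k,a).$$ (These are the data of the first-order recurrences $p_1F(n+1,k,a)+p_2F(n,k,a)=G(n,k+1,a)-G(n,k,a)$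 and $p_3F(n,k,a+1)+p_4F(n,k,a)=\mathcal G(n,k+1,a)-\mathcal G(n,k,a)$ produced by Zeilberger's algorithm.) Set $$g_1=-\frac{G(n,0,a)}{p_2(n,a)},\quad g_2=-\frac{p_1(n,a)}{p_2(n,a)},\quad g_3=-\frac{\mathcal G(n,0,a)}{p_4(n,a)},\quad g_4=-\frac{p_3(n,a)}{p_4(n,a)},$$ $$g_5(n,a)=g_1(n,a)+g_2(n,a)\,g_3(n+1,a),\qquad g_6(n,a)=g_2(n,a)\,g_4(n+1,a).$$ Standing assumptions, required for every integer $j\ge 0$: (i) all Gamma functions occurring in $F(n+j,k,a+j)$ and $F(n+j+1,k,a+j)$, $k\ge 0$, are evaluated away from their poles, and $p_2(n+j,a+j)\neq0$, $p_4(n+j+1,a+j)\ne 0$; (ii) the series defining $\mathfrak f(n+j,a+j)$ and $\mathfrak f(n+j+1,a+j)$ converge; (iii) $\lim_{k\to\infty}G(n+j,k,a+j)=0$ and $\lim_{k\to\infty}\mathcal G(n+j+1,k,a+j)=0$; (iv) $\lim_{m\to\infty}\Big(\prod_{i=0}^{m}g_6(n+i,a+i)\Big)\mathfrak f(n+m+1,a+m+1)=0$. *)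

(* Defs.v *)
From Stdlib Require Import Reals Factorial.
From Coquelicot Require Import Coquelicot.
Open Scope R_scope.
Open Scope C_scope.

(* Naturals enter complex formulas as [INR k], through the coercion [RtoC]. *)

Definition is_Clim_seq (u : nat -> C) (l : C) : Prop :=
  filterlim u eventually (locally l).

(* Coordinatewise, like [C_lim]; the value is meaningful only when [u]
   converges. *)
Definition CLim_seq (u : nat -> C) : C :=
  (real (Lim_seq (fun m => fst (u m))), real (Lim_seq (fun m => snd (u m)))).

(* Meaningful only under [ex_series u]. *)
Definition CSeries (u : nat -> C) : C :=
  (Series (fun k => fst (u k)), Series (fun k => snd (u k))).

(* [Cprod m u] is the product of the [u i] for [i < m]. *)
Fixpoint Cprod (m : nat) (u : nat -> C) : C :=
  match m with
  | O => 1
  | S m' => Cprod m' u * u m'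
  end.

(* [x] to the power [z], i.e. exp (z ln x), for a positive real [x]. *)
Definition Rpow_C (x : R) (z : C) : C :=
  ((exp (fst z * ln x) * cos (snd z * ln x))%R,
   (exp (fst z * ln x) * sin (snd z * ln x))%R).

(* The Gamma function by Gauss's formula
   Gamma z = lim m! m^z / (z (z + 1) ... (z + m)),
   valid for every [z] that is not one of the poles 0, -1, -2, ... *)
Definition Gamma (z : C) : C :=
  CLim_seq (fun m =>
    INR (fact m) * Rpow_C (INR m) z / Cprod (S m) (fun i => z + INR i)).

Definition Gamma_pole (z : C) : Prop := exists m : nat, z = - INR m.

Definition rising (x y : C) : C := Gamma (x + y) / Gamma x.

Definition rising_regular (x y : C) : Prop :=
  ~ Gamma_pole x /\ ~ Gamma_pole (x + y).

(* All functions below take the fixed parameters [b c d e f] first, even when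
   they do not depend on some of them. *)

Definition F (b c d e f n : C) (k : nat) (a : C) : C :=
  (rising a (INR k + f) * rising b (INR k + e))
  / (rising (n + a) (INR k + d) * rising n (INR k + c)).

Definition F_regular (b c d e f n : C) (k : nat) (a : C) : Prop :=
  rising_regular a (INR k + f) /\ rising_regular b (INR k + e) /\
  rising_regular (n + a) (INR k + d) /\ rising_regular n (INR k + c).

Definition F_sum (b c d e f n a : C) : C :=
  CSeries (fun k => F b c d e f n k a).

Definition cA (b c d e f n a : C) : C := a + f.
Definition cB (b c d e f n a : C) : C := b + e.
Definition cC (b c d e f n a : C) : C := n + c.
Definition cD (b c d e f n a : C) : C := n + a + d.

Definition s (b c d e f n a : C) : C :=
  cA b c d e f n a + cB b c d e f n a - cC b c d e f n a - cD b c d e f n a.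

Definition p1 (b c d e f n a : C) : C :=
  let A := cA b c d e f n a in
  let B := cB b c d e f n a in
  let C := cC b c d e f n a in
  let D := cD b c d e f n a in
  (D - A) * (A - C) * (C - B) * (D - B).

Definition p2 (b c d e f n a : C) : C :=
  n * (a + n) * s b c d e f n a * (s b c d e f n a + 1).

Definition p3 (b c d e f n a : C) : C := a * (b - d + e - n - a).

Definition p4 (b c d e f n a : C) : C := (n + a) * (- c + f - n + a + 1).

(* [cert1], [G1] belong to the recurrence in [n]; [cert2], [G2] to the one in [a]. *)

Definition cert1 (b c d e f n : C) (k : nat) (a : C) : C :=
  let A := cA b c d e f n a in
  let B := cB b c d e f n a in
  let C := cC b c d e f n a in
  let D := cD b c d e f n a in
  let s := s b c d e f n a in
  n * (a + n) * (s * INR k + s * (C + D - 1) - A * B + C * D).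

Definition cert2 (b c d e f n : C) (k : nat) (a : C) : C :=
  (n + a) * (c + INR k + n - 1).

Definition G1 (b c d e f n : C) (k : nat) (a : C) : C :=
  cert1 b c d e f n k a * F b c d e f n k a.

Definition G2 (b c d e f n : C) (k : nat) (a : C) : C :=
  cert2 b c d e f n k a * F b c d e f n k a.

Definition g1 (b c d e f n a : C) : C :=
  - (G1 b c d e f n 0 a / p2 b c d e f n a).

Definition g2 (b c d e f n a : C) : C :=
  - (p1 b c d e f n a / p2 b c d e f n a).

Definition g3 (b c d e f n a : C) : C :=
  - (G2 b c d e f n 0 a / p4 b c d e f n a).

Definition g4 (b c d e f n a : C) : C :=
  - (p3 b c d e f n a / p4 b c d e f n a).

Definition g5 (b c d e f n a : C) : C :=
  g1 b c d e f n a + g2 b c d e f n a * g3 b c d e f (n + 1) a.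

Definition g6 (b c d e f n a : C) : C :=
  g2 b c d e f n a * g4 b c d e f (n + 1) a.

(* Main.v *)
Require Import Defs.
From Stdlib Require Import Reals Factorial Lra Lia.
From Coquelicot Require Import Coquelicot.
Open Scope R_scope.
Open Scope C_scope.

(** The identity is an iterated first-order recurrence for the sum f(n, a) of
    the series, along the diagonal (n, a), (n+1, a+1), ...

    Each certificate recurrence is linear in two neighbouring values of F with
    coefficients free of k, and its right-hand side is a difference in k.
    Summed over k >= 0, that side collapses to minus the value at k = 0,
    because the certificate terms tend to 0. Dividing by p2 and by p4 gives
    f(n, a) = g1 + g2 f(n+1, a) and f(n, a) = g3 + g4 f(n, a+1)
    ([F_sum_rec_n], [F_sum_rec_a]); using the second one at (n+1, a) inside
    the first yields f(n, a) = g5 + g6 f(n+1, a+1). Iterating along the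
    diagonal, the partial sums of the accelerated series differ from f(n, a)
    exactly by the remainder that is assumed to vanish
    ([is_series_of_iteration]).

    The certificate recurrences themselves are identities of rational
    functions once the ratios F(n, k+1, a) / F, F(n+1, k, a) / F and
    F(n, k, a+1) / F are known ([F_succ_k], [F_succ_n], [F_succ_a]), and these
    ratios come from Gamma (z + 1) = z Gamma z ([Gamma_succ]). As Gamma is the
    limit of Gauss's products, the functional equation holds for the products
    up to a factor tending to 1, and what needs an argument is that the
    products converge at every complex z off the poles. Two consecutive
    products have ratio (1 + 1/m)^z / (1 + z/(m+1)) = 1 + O(1/m^2)
    ([gauss_increment]), and a sequence with such ratios converges
    ([ex_Clim_seq_of_ratio]). *)

(** * Limits and series of complex numbers, by components *)

Lemma is_Clim_seq_components (u : nat -> C) (l : C) :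
  is_Clim_seq u l <->
  is_lim_seq (fun m => fst (u m)) (fst l) /\
  is_lim_seq (fun m => snd (u m)) (snd l).
Proof.
split.
- intros H; split; apply filterlim_locally; intros eps;
    generalize (proj1 (filterlim_locally _ _) H eps);
    apply filter_imp; intros m Hm; apply Hm.
- intros [H1 H2]; apply filterlim_locally; intros eps.
  apply (filter_imp (fun m => ball (fst l) eps (fst (u m)) /\
                              ball (snd l) eps (snd (u m)))).
  + intros m Hm; exact Hm.
  + apply filter_and.
    * exact (proj1 (filterlim_locally _ _) H1 eps).
    * exact (proj1 (filterlim_locally _ _) H2 eps).
Qed.

Lemma CLim_seq_unique (u : nat -> C) (l : C) :
  is_Clim_seq u l -> CLim_seq u = l.
Proof.
intros [H1 H2]%is_Clim_seq_components; unfold CLim_seq.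
rewrite (is_lim_seq_unique _ _ H1), (is_lim_seq_unique _ _ H2).
now destruct l.
Qed.

Lemma is_Clim_seq_unique (u : nat -> C) (l l' : C) :
  is_Clim_seq u l -> is_Clim_seq u l' -> l = l'.
Proof.
intros H H'; rewrite <- (CLim_seq_unique _ _ H); exact (CLim_seq_unique _ _ H').
Qed.

Lemma is_Clim_seq_ext_loc (u v : nat -> C) (l : C) :
  eventually (fun m => u m = v m) -> is_Clim_seq u l -> is_Clim_seq v l.
Proof. apply filterlim_ext_loc. Qed.

Lemma is_Clim_seq_const (c : C) : is_Clim_seq (fun _ => c) c.
Proof. apply filterlim_const. Qed.

Lemma is_Clim_seq_plus (u v : nat -> C) (l l' : C) :
  is_Clim_seq u l -> is_Clim_seq v l' ->
  is_Clim_seq (fun m => u m + v m) (l + l').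
Proof.
rewrite !is_Clim_seq_components; intros [H1 H2] [H1' H2'].
now split; apply is_lim_seq_plus'.
Qed.

Lemma is_Clim_seq_mult (u v : nat -> C) (l l' : C) :
  is_Clim_seq u l -> is_Clim_seq v l' ->
  is_Clim_seq (fun m => u m * v m) (l * l').
Proof.
rewrite !is_Clim_seq_components; intros [H1 H2] [H1' H2']; split.
- now apply is_lim_seq_minus'; apply is_lim_seq_mult'.
- now apply is_lim_seq_plus'; apply is_lim_seq_mult'.
Qed.

Lemma is_Clim_seq_incr_n (u : nat -> C) (N : nat) (l : C) :
  is_Clim_seq u l <-> is_Clim_seq (fun m => u (m + N)%nat) l.
Proof.
rewrite !is_Clim_seq_components.
now rewrite (is_lim_seq_incr_n (fun m => fst (u m)) N),
  (is_lim_seq_incr_n (fun m => snd (u m)) N).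
Qed.

Lemma CSeries_correct (u : nat -> C) :
  ex_series (V := C_NormedModule) u ->
  is_series (V := C_NormedModule) u (CSeries u).
Proof.
assert (Hfst : forall m, fst (sum_n (G := C_NormedModule) u m)
                         = sum_n (fun k => fst (u k)) m).
{ induction m as [|m IH]; [now rewrite !sum_O|].
  rewrite !sum_Sn, <- IH; reflexivity. }
assert (Hsnd : forall m, snd (sum_n (G := C_NormedModule) u m)
                         = sum_n (fun k => snd (u k)) m).
{ induction m as [|m IH]; [now rewrite !sum_O|].
  rewrite !sum_Sn, <- IH; reflexivity. }
intros [l Hl].
destruct (proj1 (is_Clim_seq_components _ _) Hl) as [H1 H2].
unfold CSeries.
rewrite (is_series_unique (fun k => fst (u k)) (fst l)),
  (is_series_unique (fun k => snd (u k)) (snd l)).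
- now destruct l.
- exact (is_lim_seq_ext _ _ _ Hsnd H2).
- exact (is_lim_seq_ext _ _ _ Hfst H1).
Qed.

Lemma fst_le_Cmod (z : C) : (Rabs (fst z) <= Cmod z)%R.
Proof. exact (Rle_trans _ _ _ (Rmax_l _ _) (Rmax_Cmod z)). Qed.

Lemma snd_le_Cmod (z : C) : (Rabs (snd z) <= Cmod z)%R.
Proof. exact (Rle_trans _ _ _ (Rmax_r _ _) (Rmax_Cmod z)). Qed.

Lemma Cmod_le_components (z : C) : (Cmod z <= Rabs (fst z) + Rabs (snd z))%R.
Proof.
unfold Cmod.
assert (H1 := Rabs_pos (fst z)); assert (H2 := Rabs_pos (snd z)).
rewrite <- (sqrt_Rsqr (Rabs (fst z) + Rabs (snd z))) by lra.
apply sqrt_le_1_alt.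
rewrite <- (pow2_abs (fst z)), <- (pow2_abs (snd z)).
unfold Rsqr; nra.
Qed.

Lemma ex_lim_seq_of_increments (x b : nat -> R) :
  ex_series b -> (forall m, Rabs (x (S m) - x m) <= b m)%R ->
  exists l : R, is_lim_seq x l.
Proof.
intros Hb Hx.
destruct (ex_series_le (K := R_AbsRing) (V := R_CompleteNormedModule)
            (fun m => (x (S m) - x m)%R) b Hx Hb) as [l Hl].
exists (x O + l)%R.
apply is_lim_seq_incr_1.
apply (is_lim_seq_ext
         (fun m => x O + sum_n (fun k => (x (S k) - x k)%R) m)%R).
- intros m; induction m as [|m IH].
  + rewrite sum_O; ring.
  + rewrite sum_Sn; change plus with Rplus; lra.
- apply is_lim_seq_plus'; [apply is_lim_seq_const | exact Hl].
Qed.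

(** A sequence whose consecutive ratios are 1 + O(b m) with [b] summable is
    bounded, its growth being at most the exponential of the sum of [b]; its
    increments are then summable too. *)
Lemma ex_Clim_seq_of_ratio (u : nat -> C) (b : nat -> R) :
  (forall m, 0 <= b m)%R -> ex_series b ->
  (forall m, Cmod (u (S m) - u m) <= b m * Cmod (u m))%R ->
  exists l : C, is_Clim_seq u l.
Proof.
intros Hb0 Hb Hu.
assert (Hsum : forall m, (sum_n b m <= Series b)%R).
{ apply (is_lim_seq_incr_compare (sum_n b) (Series b)).
  - exact (Series_correct b Hb).
  - intros m; rewrite sum_Sn; change plus with Rplus.
    specialize (Hb0 (S m)); lra. }
assert (Hgrow : forall m, (Cmod (u (S m)) <= (1 + b m) * Cmod (u m))%R).
{ intros m; replace (u (S m)) with (u (S m) - u m + u m) by ring.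
  eapply Rle_trans; [apply Cmod_triangle|]. specialize (Hu m); lra. }
assert (Hexp : forall m, (Cmod (u (S m)) <= exp (sum_n b m) * Cmod (u O))%R).
{ induction m as [|m IH].
  - rewrite sum_O; eapply Rle_trans; [apply Hgrow|].
    apply Rmult_le_compat_r; [apply Cmod_ge_0 | apply exp_ineq1_le].
  - rewrite sum_Sn; change plus with Rplus.
    rewrite exp_plus, (Rmult_comm (exp (sum_n b m))), Rmult_assoc.
    eapply Rle_trans; [apply Hgrow|].
    apply Rmult_le_compat; [specialize (Hb0 (S m)); lra | apply Cmod_ge_0
                           | apply exp_ineq1_le | exact IH]. }
set (M := (exp (Series b) * Cmod (u O))%R).
assert (HM : forall m, (Cmod (u m) <= M)%R).
{ assert (Hmono : forall x, (x <= Series b)%R -> (exp x * Cmod (u O) <= M)%R).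
  { intros x Hx; apply Rmult_le_compat_r; [apply Cmod_ge_0|].
    destruct (Rle_lt_or_eq_dec _ _ Hx) as [Hlt|Heq].
    - apply Rlt_le, exp_increasing, Hlt.
    - rewrite Heq; apply Rle_refl. }
  intros [|m].
  - rewrite <- (Rmult_1_l (Cmod (u O))), <- exp_0; apply Hmono.
    apply (Rle_trans _ (sum_n b 0)); [rewrite sum_O; apply Hb0 | apply Hsum].
  - eapply Rle_trans; [apply Hexp | apply Hmono, Hsum]. }
assert (Hstep : forall m, (Cmod (u (S m) - u m) <= M * b m)%R).
{ intros m; eapply Rle_trans; [apply Hu|].
  rewrite Rmult_comm; apply Rmult_le_compat_r; [apply Hb0 | apply HM]. }
assert (HMb : ex_series (fun m => M * b m)%R)
  by exact (ex_series_scal (V := R_NormedModule) M b Hb).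
destruct (ex_lim_seq_of_increments (fun m => fst (u m)) _ HMb) as [l1 Hl1].
{ intros m; exact (Rle_trans _ _ _ (fst_le_Cmod (u (S m) - u m)) (Hstep m)). }
destruct (ex_lim_seq_of_increments (fun m => snd (u m)) _ HMb) as [l2 Hl2].
{ intros m; exact (Rle_trans _ _ _ (snd_le_Cmod (u (S m) - u m)) (Hstep m)). }
exists (l1, l2); now apply is_Clim_seq_components.
Qed.

(** * Expansion of complex powers of a number near 1 *)

Lemma exp_order2 (x : R) :
  (Rabs x <= 1 / 2)%R -> (Rabs (exp x - 1 - x) <= 2 * x ^ 2)%R.
Proof.
intros [Hl Hu]%Rabs_le_between.
assert (H1 := exp_ineq1_le x); assert (H2 := exp_ineq1_le (- x)).
assert (H3 : (exp x * exp (- x) = 1)%R)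
  by (rewrite <- exp_plus, Rplus_opp_r; apply exp_0).
assert (H4 := exp_pos x).
rewrite Rabs_pos_eq by lra.
(* The upper bound comes from exp (- x) >= 1 - x, that is
   exp x <= 1 / (1 - x). *)
assert (H5 : (exp x * (1 - x) <= 1)%R) by nra.
assert (H6 : ((exp x - 1 - x) * (1 - x) <= x ^ 2)%R) by nra.
nra.
Qed.

Lemma Rabs_sin_le (y : R) : (Rabs (sin y) <= Rabs y)%R.
Proof.
destruct (MVT_abs sin cos 0 y) as [c [Hc _]].
{ intros c _; apply derivable_pt_lim_sin. }
rewrite sin_0, !Rminus_0_r in Hc; rewrite Hc.
rewrite <- (Rmult_1_l (Rabs y)) at 2.
apply Rmult_le_compat_r; [apply Rabs_pos|].
apply Rabs_le, COS_bound.
Qed.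

Lemma cos_order2 (y : R) : (Rabs (cos y - 1) <= y ^ 2 / 2)%R.
Proof.
replace y with (2 * (y / 2))%R at 1 by field.
rewrite cos_2a_sin.
assert (H := Rabs_sin_le (y / 2)).
assert (H2 := Rsqr_le_abs_1 _ _ H); unfold Rsqr in H2.
rewrite Rabs_left1; nra.
Qed.

Lemma sin_order3 (y : R) : (Rabs (sin y - y) <= y ^ 2 / 2 * Rabs y)%R.
Proof.
destruct (MVT_abs (fun y => sin y - y)%R (fun y => cos y - 1)%R 0 y)
  as [c [Hc Hcy]].
{ intros c _; apply derivable_pt_lim_minus;
    [apply derivable_pt_lim_sin | apply derivable_pt_lim_id]. }
rewrite sin_0, !Rminus_0_r in Hc; rewrite Hc.
apply Rmult_le_compat_r; [apply Rabs_pos|].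
apply (Rle_trans _ _ _ (cos_order2 c)).
assert (Rabs c <= Rabs y)%R.
{ revert Hcy; unfold Rmin, Rmax, Rabs.
  destruct (Rle_dec 0 y), (Rcase_abs c), (Rcase_abs y); lra. }
assert (H2 := Rsqr_le_abs_1 _ _ H); unfold Rsqr in H2; nra.
Qed.

(** The exponential function satisfies exp w = 1 + w + O(w^2) near 0; here
    w = t z, and the base [exp t] turns the power into this exponential. *)
Lemma Rpow_C_order2 (t : R) (z : C) :
  (0 <= t)%R -> (t * Cmod z <= 1 / 2)%R ->
  (Cmod (Rpow_C (exp t) z - 1 - t * z) <= 4 * (t * Cmod z) ^ 2)%R.
Proof.
intros Ht Hz.
set (x := (fst z * t)%R); set (y := (snd z * t)%R); set (r := (t * Cmod z)%R).
assert (Hx : (Rabs x <= r)%R).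
{ unfold x, r; rewrite Rabs_mult, (Rabs_pos_eq t Ht), Rmult_comm.
  apply Rmult_le_compat_l, fst_le_Cmod; exact Ht. }
assert (Hy : (Rabs y <= r)%R).
{ unfold y, r; rewrite Rabs_mult, (Rabs_pos_eq t Ht), Rmult_comm.
  apply Rmult_le_compat_l, snd_le_Cmod; exact Ht. }
assert (Hr : (r ^ 2 = x ^ 2 + y ^ 2)%R).
{ unfold r; rewrite Rpow_mult_distr, Cmod2_alt; unfold Re, Im, x, y; ring. }
assert (Hexp := exp_order2 x ltac:(unfold r in *; lra)).
assert (Hcos := cos_order2 y); assert (Hsin := sin_order3 y).
assert (Hexp0 : (Rabs (exp x - 1) <= 2 * Rabs x)%R).
{ replace (exp x - 1)%R with ((exp x - 1 - x) + x)%R by ring.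
  apply (Rle_trans _ _ _ (Rabs_triang _ _)).
  assert (Hx0 := Rabs_pos x); rewrite <- (pow2_abs x) in Hexp.
  unfold r in *; nra. }
assert (Hexp2 : (exp x <= 2)%R).
{ assert (H := proj1 (Rabs_le_between _ _) Hexp0); unfold r in *; lra. }
apply (Rle_trans _ _ _ (Cmod_le_components _)).
replace (fst (Rpow_C (exp t) z - 1 - t * z))
  with ((exp x - 1 - x) + exp x * (cos y - 1))%R
  by (cbn; rewrite ln_exp; fold x y; unfold x; ring).
replace (snd (Rpow_C (exp t) z - 1 - t * z))
  with ((exp x - 1) * sin y + (sin y - y))%R
  by (cbn; rewrite ln_exp; fold x y; unfold y; ring).
assert (H1 := Rabs_triang (exp x - 1 - x) (exp x * (cos y - 1))).
assert (H2 := Rabs_triang ((exp x - 1) * sin y) (sin y - y)).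
rewrite Rabs_mult, (Rabs_pos_eq (exp x)) in H1 by apply Rlt_le, exp_pos.
rewrite Rabs_mult in H2.
assert (H3 : (exp x * Rabs (cos y - 1) <= 2 * (y ^ 2 / 2))%R).
{ apply Rmult_le_compat; try assumption;
    [apply Rlt_le, exp_pos | apply Rabs_pos]. }
assert (H4 : (Rabs (exp x - 1) * Rabs (sin y) <= 2 * Rabs x * Rabs y)%R).
{ apply Rmult_le_compat; try apply Rabs_pos; [assumption | apply Rabs_sin_le]. }
assert (H5 : (2 * Rabs x * Rabs y <= x ^ 2 + y ^ 2)%R).
{ rewrite <- (pow2_abs x), <- (pow2_abs y).
  assert (H := pow2_ge_0 (Rabs x - Rabs y)); lra. }
assert (H6 : (y ^ 2 / 2 * Rabs y <= y ^ 2)%R).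
{ assert (H := pow2_ge_0 y); unfold r in *; nra. }
assert (H7 := pow2_ge_0 x); assert (H8 := pow2_ge_0 y).
fold r; rewrite Hr; lra.
Qed.

Lemma Rpow_C_mult (x y : R) (z : C) :
  (0 < x)%R -> (0 < y)%R -> Rpow_C (x * y) z = Rpow_C x z * Rpow_C y z.
Proof.
intros Hx Hy; unfold Rpow_C.
rewrite (ln_mult x y Hx Hy), !Rmult_plus_distr_l, exp_plus, cos_plus, sin_plus.
apply injective_projections; cbn; ring.
Qed.

Lemma Rpow_C_succ (x : R) (z : C) :
  (0 < x)%R -> Rpow_C x (z + 1) = x * Rpow_C x z.
Proof.
intros Hx; unfold Rpow_C; cbn.
rewrite Rplus_0_r, Rmult_plus_distr_r, Rmult_1_l, exp_plus, (exp_ln x Hx).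
apply injective_projections; cbn; ring.
Qed.

Lemma Cprod_neq0 (m : nat) (u : nat -> C) :
  (forall i, (i < m)%nat -> u i <> 0) -> Cprod m u <> 0.
Proof.
induction m as [|m IH]; intros Hu; cbn.
- apply C1_nz.
- apply Cmult_neq_0; [apply IH; intros i Hi|]; apply Hu; lia.
Qed.

Lemma Cprod_succ_l (m : nat) (u : nat -> C) :
  Cprod (S m) u = u O * Cprod m (fun i => u (S i)).
Proof.
induction m as [|m IH]; [cbn; ring|].
change (Cprod (S m) u * u (S m)
        = u O * (Cprod m (fun i => u (S i)) * u (S m))).
rewrite IH; ring.
Qed.

Lemma Cprod_ext (m : nat) (u v : nat -> C) :
  (forall i, u i = v i) -> Cprod m u = Cprod m v.
Proof.
intros H; induction m as [|m IH]; cbn; [|rewrite IH, H]; reflexivity.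
Qed.

Lemma C_INR_S (m : nat) : RtoC (INR (S m)) = INR m + 1.
Proof. rewrite S_INR; apply RtoC_plus. Qed.

Lemma INR_S_neq0 (m : nat) : RtoC (INR (S m)) <> 0.
Proof. intros H%RtoC_inj; exact (not_0_INR (S m) ltac:(lia) H). Qed.

Lemma nonpole_shift_neq0 (z : C) (m : nat) : ~ Gamma_pole z -> z + INR m <> 0.
Proof.
intros Hz H; apply Hz; exists m.
replace z with (z + INR m - INR m) by ring; rewrite H; ring.
Qed.

Lemma nonpole_neq0 (z : C) : ~ Gamma_pole z -> z <> 0.
Proof.
intros Hz; rewrite <- (Cplus_0_r z); exact (nonpole_shift_neq0 z 0 Hz).
Qed.

(** * Gauss's products and the functional equation of Gamma *)

Definition gauss (z : C) (m : nat) : C :=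
  INR (fact m) * Rpow_C (INR m) z / Cprod (S m) (fun i => z + INR i).

Lemma gauss_succ (z : C) (m : nat) : ~ Gamma_pole z ->
  gauss z (S (S m)) =
  gauss z (S m) * Rpow_C (1 + / INR (S m)) z / (1 + z / INR (S (S m))).
Proof.
intros Hz; unfold gauss.
assert (Hm : (0 < INR (S m))%R) by (apply lt_0_INR; lia).
replace (INR (S (S m))) with (INR (S m) * (1 + / INR (S m)))%R at 1
  by (rewrite (S_INR (S m)); field; lra).
rewrite Rpow_C_mult; [|exact Hm|].
2:{ assert (H := Rinv_0_lt_compat _ Hm); lra. }
change (Cprod (S (S (S m))) (fun i => z + INR i))
  with (Cprod (S (S m)) (fun i => z + INR i) * (z + INR (S (S m)))).
change (fact (S (S m))) with (S (S m) * fact (S m))%nat.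
rewrite mult_INR, RtoC_mult.
assert (HP : Cprod (S (S m)) (fun i => z + INR i) <> 0)
  by (apply Cprod_neq0; intros i _; apply nonpole_shift_neq0, Hz).
assert (Hl := nonpole_shift_neq0 z (S (S m)) Hz).
assert (HS := INR_S_neq0 (S m)).
field; repeat split; try assumption.
rewrite Cplus_comm; exact Hl.
Qed.

Lemma ln_succ_ratio (m : nat) :
  (/ INR (S (S m)) <= ln (1 + / INR (S m)) <= / INR (S m))%R.
Proof.
assert (Hm : (0 < INR (S m))%R) by (apply lt_0_INR; lia).
assert (Hm' : (0 < INR (S (S m)))%R) by (apply lt_0_INR; lia).
assert (Hi := Rinv_0_lt_compat _ Hm); assert (Hi' := Rinv_0_lt_compat _ Hm').
assert (Hln : forall x, (0 < x)%R -> (ln x <= x - 1)%R).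
{ intros x Hx; assert (H := exp_ineq1_le (ln x)).
  rewrite (exp_ln x Hx) in H; lra. }
split.
- assert (E : (1 + / INR (S m) = / (1 - / INR (S (S m))))%R).
  { rewrite (S_INR (S m)) in *; field; lra. }
  assert (Hp : (0 < 1 - / INR (S (S m)))%R).
  { rewrite <- (Rinv_inv (1 - / INR (S (S m)))), <- E.
    apply Rinv_0_lt_compat; lra. }
  rewrite E, (ln_Rinv _ Hp); specialize (Hln _ Hp); lra.
- specialize (Hln (1 + / INR (S m))%R ltac:(lra)); lra.
Qed.

(** The ratio of the two products is w / (1 + z q) with w = exp (t z),
    t = ln (1 + p), p = 1/m and q = 1/(m+1). The first-order terms t z and
    q z agree up to (p - q) z, the rest of w is quadratic in p, and
    p^2 <= 2 (p - q), so every error is a multiple of p - q. That bound is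
    the convenient one because p - q is summable by telescoping. *)
Lemma gauss_increment (z : C) (m : nat) : ~ Gamma_pole z ->
  (2 * Cmod z <= INR (S m))%R ->
  (Cmod (gauss z (S (S m)) - gauss z (S m)) <=
   2 * (8 * Cmod z ^ 2 + Cmod z) * (/ INR (S m) - / INR (S (S m)))
   * Cmod (gauss z (S m)))%R.
Proof.
intros Hz Hzm; rewrite (gauss_succ z m Hz).
set (t := ln (1 + / INR (S m))).
set (p := (/ INR (S m))%R); set (q := (/ INR (S (S m)))%R).
destruct (ln_succ_ratio m) as [Hqt Htp]; fold t p q in Hqt, Htp.
assert (Hm : (0 < INR (S m))%R) by (apply lt_0_INR; lia).
assert (Hm' : (INR (S (S m)) = INR (S m) + 1)%R) by apply S_INR.
assert (Hq : (0 < q)%R) by (apply Rinv_0_lt_compat; lra).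
assert (Hpq : (p - q = p * q)%R) by (unfold p, q; rewrite Hm'; field; lra).
assert (Hp2 : (p ^ 2 <= 2 * (p - q))%R).
{ assert (Hp1 : (p <= 1)%R).
  { unfold p; rewrite <- Rinv_1; apply Rinv_le_contravar; [lra|].
    rewrite S_INR; assert (H := pos_INR m); lra. }
  nra. }
assert (Hz0 := Cmod_ge_0 z).
assert (Hpz : (p * Cmod z <= 1 / 2)%R).
{ apply (Rmult_le_reg_l (INR (S m))); [exact Hm|].
  unfold p; rewrite <- Rmult_assoc, Rinv_r; lra. }
assert (Hden : (1 / 2 <= Cmod (1 + z / INR (S (S m))))%R).
{ assert (H := Cmod_triangle (1 + z / INR (S (S m))) (- (z / INR (S (S m))))).
  replace (1 + z / INR (S (S m)) + - (z / INR (S (S m)))) with (RtoC 1) in H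
    by (field; apply INR_S_neq0).
  rewrite Cmod_1, Cmod_opp, Cmod_div, Cmod_R, Rabs_pos_eq in H
    by (apply INR_S_neq0 || lra).
  unfold Rdiv in H; fold q in H; nra. }
assert (Hden0 : 1 + z / INR (S (S m)) <> 0) by (apply Cmod_gt_0; lra).
assert (Et : (exp t = 1 + p)%R) by (apply exp_ln; fold p; lra).
rewrite <- Et.
set (w := Rpow_C (exp t) z).
replace (gauss z (S m) * w / (1 + z / INR (S (S m))) - gauss z (S m))
  with (((w - 1 - t * z) + (t - q) * z) / (1 + z / INR (S (S m)))
        * gauss z (S m)).
2:{ unfold q; rewrite RtoC_inv by lra.
    field; split; [apply INR_S_neq0|].
    intros H; apply Hden0.
    replace (1 + z / INR (S (S m)))
      with ((INR (S (S m)) + z) / INR (S (S m))) by (field; apply INR_S_neq0).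
    rewrite H; unfold Cdiv; apply Cmult_0_l. }
rewrite Cmod_mult; apply Rmult_le_compat_r; [apply Cmod_ge_0|].
rewrite Cmod_div by exact Hden0.
apply Rle_div_l; [lra|].
assert (Hnum : (Cmod (w - 1 - t * z + (t - q) * z)
                <= (8 * Cmod z ^ 2 + Cmod z) * (p - q))%R).
{ apply (Rle_trans _ _ _ (Cmod_triangle _ _)).
  rewrite Cmod_mult, <- RtoC_minus, Cmod_R, Rabs_pos_eq by lra.
  assert (H := Rpow_C_order2 t z ltac:(lra) ltac:(nra)); fold w in H.
  assert (H1 : ((t * Cmod z) ^ 2 <= p ^ 2 * Cmod z ^ 2)%R).
  { rewrite Rpow_mult_distr; apply Rmult_le_compat_r; [apply pow2_ge_0|].
    apply pow_incr; lra. }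
  assert (H2 : (p ^ 2 * Cmod z ^ 2 <= 2 * (p - q) * Cmod z ^ 2)%R)
    by (apply Rmult_le_compat_r; [apply pow2_ge_0 | exact Hp2]).
  assert (H3 : ((t - q) * Cmod z <= (p - q) * Cmod z)%R)
    by (apply Rmult_le_compat_r; lra).
  lra. }
assert (H0 : (0 <= (8 * Cmod z ^ 2 + Cmod z) * (p - q))%R).
{ assert (H := pow2_ge_0 (Cmod z)); apply Rmult_le_pos; lra. }
nra.
Qed.

Lemma ex_series_telescoping (x : nat -> R) (l : R) :
  is_lim_seq x l -> ex_series (fun m => x m - x (S m))%R.
Proof.
intros Hx; exists (x O - l)%R.
change (is_lim_seq (sum_n (fun m => x m - x (S m))%R) (x O - l)%R).
apply (is_lim_seq_ext (fun m => x O - x (S m))%R).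
- intros m; induction m as [|m IH].
  + now rewrite sum_O.
  + rewrite sum_Sn, <- IH; change plus with Rplus; ring.
- apply is_lim_seq_minus'; [apply is_lim_seq_const|].
  now apply is_lim_seq_incr_1 in Hx.
Qed.

Lemma is_lim_seq_inv_INR : is_lim_seq (fun m => / INR m)%R 0.
Proof.
apply (is_lim_seq_inv _ p_infty); [apply is_lim_seq_INR | discriminate].
Qed.

Lemma ex_Clim_seq_gauss (z : C) :
  ~ Gamma_pole z -> exists l : C, is_Clim_seq (gauss z) l.
Proof.
intros Hz.
destruct (INR_unbounded (2 * Cmod z)) as [N HN].
destruct (ex_Clim_seq_of_ratio (fun m => gauss z (m + S N)%nat)
  (fun m => 2 * (8 * Cmod z ^ 2 + Cmod z)
            * (/ INR (m + S N) - / INR (S m + S N)))%R) as [l Hl].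
- intros m.
  assert (0 < INR (m + S N))%R by (apply lt_0_INR; lia).
  assert (/ INR (S m + S N) <= / INR (m + S N))%R
    by (apply Rinv_le_contravar; [assumption | apply le_INR; lia]).
  assert (H1 := Cmod_ge_0 z); assert (H2 := pow2_ge_0 (Cmod z)).
  apply Rmult_le_pos; lra.
- apply (ex_series_scal (V := R_NormedModule)).
  apply (ex_series_telescoping (fun m => / INR (m + S N))%R 0).
  apply (is_lim_seq_incr_n (fun m => / INR m)%R), is_lim_seq_inv_INR.
- intros m; replace (S m + S N)%nat with (S (S (m + N))) by lia.
  replace (m + S N)%nat with (S (m + N)) by lia.
  apply gauss_increment; [exact Hz|].
  apply (Rle_trans _ (INR N)); [lra | apply le_INR; lia].
- exists l; exact (proj2 (is_Clim_seq_incr_n _ (S N) _) Hl).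
Qed.

Lemma is_Clim_seq_gauss (z : C) :
  ~ Gamma_pole z -> is_Clim_seq (gauss z) (Gamma z).
Proof.
intros [l Hl]%ex_Clim_seq_gauss.
change (Gamma z) with (CLim_seq (gauss z)).
now rewrite (CLim_seq_unique _ _ Hl).
Qed.

Lemma nonpole_succ (z : C) : ~ Gamma_pole z -> ~ Gamma_pole (z + 1).
Proof.
intros Hz [m Hm]; apply Hz; exists (S m).
rewrite C_INR_S; replace z with (z + 1 - 1) by ring; rewrite Hm; ring.
Qed.

Lemma is_Clim_seq_inv_INR : is_Clim_seq (fun m => RtoC (/ INR m)) 0.
Proof.
apply is_Clim_seq_components; split; [apply is_lim_seq_inv_INR|].
apply is_lim_seq_const.
Qed.

(** Passing from z to z + 1 shifts the denominator by one factor and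
    multiplies the power by m, so the functional equation holds for the
    products up to the factor 1 + (z + 1)/m. *)
Lemma gauss_arg_succ (z : C) (m : nat) : ~ Gamma_pole z ->
  gauss (z + 1) (S m) * (1 + (z + 1) * RtoC (/ INR (S m))) = z * gauss z (S m).
Proof.
intros Hz; unfold gauss.
rewrite Rpow_C_succ by (apply lt_0_INR; lia).
set (X := Cprod (S (S m)) (fun i => z + 1 + INR i)).
set (Y := Cprod (S (S m)) (fun i => z + INR i)).
assert (HX : X <> 0) by (apply Cprod_neq0; intros i _;
                         apply nonpole_shift_neq0, nonpole_succ, Hz).
assert (E : z * X = Y * (z + 1 + INR (S m))).
{ assert (E : Cprod (S (S (S m))) (fun i => z + INR i) = z * X).
  { rewrite Cprod_succ_l; f_equal; [cbn; ring|].
    apply Cprod_ext; intros i; rewrite C_INR_S; ring. }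
  rewrite <- E.
  change (Y * (z + INR (S (S m))) = Y * (z + 1 + INR (S m))).
  rewrite (C_INR_S (S m)); ring. }
assert (HS := INR_S_neq0 m); assert (Hz0 := nonpole_neq0 z Hz).
assert (HzS := nonpole_shift_neq0 (z + 1) (S m) (nonpole_succ z Hz)).
assert (EY : Y = z * X / (z + 1 + INR (S m))) by (rewrite E; field; exact HzS).
rewrite EY, RtoC_inv by (apply not_0_INR; lia).
field; auto.
Qed.

Lemma Gamma_succ (z : C) : ~ Gamma_pole z -> Gamma (z + 1) = z * Gamma z.
Proof.
intros Hz.
apply (is_Clim_seq_unique
         (fun m => gauss (z + 1) m * (1 + (z + 1) * RtoC (/ INR m)))).
- replace (Gamma (z + 1)) with (Gamma (z + 1) * (1 + (z + 1) * 0)) by ring.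
  apply is_Clim_seq_mult; [apply is_Clim_seq_gauss, nonpole_succ, Hz|].
  apply is_Clim_seq_plus; [apply is_Clim_seq_const|].
  apply is_Clim_seq_mult; [apply is_Clim_seq_const | apply is_Clim_seq_inv_INR].
- apply (is_Clim_seq_ext_loc (fun m => z * gauss z m)).
  + exists 1%nat; intros [|m] Hm; [lia|].
    symmetry; apply gauss_arg_succ, Hz.
  + apply is_Clim_seq_mult; [apply is_Clim_seq_const|].
    apply is_Clim_seq_gauss, Hz.
Qed.

(** * Ratios of neighbouring terms *)

Lemma Cinv_0 : / 0 = 0.
Proof. apply injective_projections; cbn; unfold Rdiv; ring. Qed.

(** Division is total, with [/ 0 = 0], and multiplicative throughout. Hence
    the functional equation passes to reciprocals of Gamma values whatever
    these values are. *)
Lemma Cinv_mult (x y : C) : / (x * y) = / x * / y.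
Proof.
destruct (Ceq_dec x 0) as [->|Hx]; [now rewrite Cmult_0_l, Cinv_0, Cmult_0_l|].
destruct (Ceq_dec y 0) as [->|Hy]; [now rewrite Cmult_0_r, Cinv_0, Cmult_0_r|].
field; auto.
Qed.

Lemma rising_succ_index (x y : C) :
  rising_regular x y -> rising x (y + 1) = (x + y) * rising x y.
Proof.
intros [_ H]; unfold rising; rewrite Cplus_assoc, (Gamma_succ _ H).
unfold Cdiv; ring.
Qed.

Lemma rising_succ_base (x y : C) :
  rising_regular x y -> rising (x + 1) y = (x + y) / x * rising x y.
Proof.
intros [Hx H]; unfold rising, Cdiv.
replace (x + 1 + y) with (x + y + 1) by ring.
rewrite (Gamma_succ _ H), (Gamma_succ _ Hx).
rewrite (Cinv_mult x); ring.
Qed.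

(** Each of these is the argument of a Gamma function in the term F, and 0 is
    a pole. *)
Lemma F_regular_neq0 (b c d e f n a : C) (k : nat) :
  F_regular b c d e f n k a ->
  n <> 0 /\ a <> 0 /\ n + a <> 0 /\
  n + c + INR k <> 0 /\ n + a + d + INR k <> 0.
Proof.
intros ([Ha _] & _ & [Hna HD] & [Hn HC]).
repeat split; try now apply nonpole_neq0.
- replace (n + c + INR k) with (n + (INR k + c)) by ring;
    now apply nonpole_neq0.
- replace (n + a + d + INR k) with (n + a + (INR k + d)) by ring;
    now apply nonpole_neq0.
Qed.

Lemma F_succ_k (b c d e f n a : C) (k : nat) :
  F_regular b c d e f n k a ->
  F b c d e f n (S k) a
  = (a + f + INR k) * (b + e + INR k)
    / ((n + a + d + INR k) * (n + c + INR k)) * F b c d e f n k a.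
Proof.
intros regular.
destruct (F_regular_neq0 _ _ _ _ _ _ _ _ regular) as (_ & _ & _ & HC & HD).
destruct regular as (Ra & Rb & Rna & Rn); unfold F.
replace (INR (S k) + f) with (INR k + f + 1) by (rewrite C_INR_S; ring).
replace (INR (S k) + e) with (INR k + e + 1) by (rewrite C_INR_S; ring).
replace (INR (S k) + d) with (INR k + d + 1) by (rewrite C_INR_S; ring).
replace (INR (S k) + c) with (INR k + c + 1) by (rewrite C_INR_S; ring).
rewrite !rising_succ_index by assumption.
set (X := rising (n + a) _); set (Y := rising n _).
replace ((n + a + (INR k + d)) * X * ((n + (INR k + c)) * Y))
  with (((n + a + d + INR k) * (n + c + INR k)) * (X * Y)) by ring.
unfold Cdiv at 1; rewrite Cinv_mult.
unfold Cdiv; ring.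
Qed.

Lemma F_succ_n (b c d e f n a : C) (k : nat) :
  F_regular b c d e f n k a ->
  F b c d e f (n + 1) k a
  = n * (n + a)
    / ((n + a + d + INR k) * (n + c + INR k)) * F b c d e f n k a.
Proof.
intros regular.
destruct (F_regular_neq0 _ _ _ _ _ _ _ _ regular) as (Hn & _ & Hna & HC & HD).
destruct regular as (Ra & Rb & Rna & Rn); unfold F.
replace (n + 1 + a) with (n + a + 1) by ring.
rewrite !rising_succ_base by assumption.
set (X := rising (n + a) _); set (Y := rising n _).
replace ((n + a + (INR k + d)) / (n + a) * X * ((n + (INR k + c)) / n * Y))
  with ((n + a + d + INR k) * (n + c + INR k) / (n * (n + a)) * (X * Y))
  by (field; auto).
unfold Cdiv at 1; rewrite Cinv_mult.
replace (/ ((n + a + d + INR k) * (n + c + INR k) / (n * (n + a))))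
  with (n * (n + a) / ((n + a + d + INR k) * (n + c + INR k))) by (field; auto).
unfold Cdiv; ring.
Qed.

Lemma F_succ_a (b c d e f n a : C) (k : nat) :
  F_regular b c d e f n k a ->
  F b c d e f n k (a + 1)
  = (a + f + INR k) * (n + a) / (a * (n + a + d + INR k)) * F b c d e f n k a.
Proof.
intros regular.
destruct (F_regular_neq0 _ _ _ _ _ _ _ _ regular) as (Hn & Ha & Hna & HC & HD).
destruct regular as (Ra & Rb & Rna & Rn); unfold F.
rewrite (Cplus_assoc n a 1), !rising_succ_base by assumption.
set (X := rising (n + a) _); set (Y := rising n _).
replace ((n + a + (INR k + d)) / (n + a) * X * Y)
  with (((n + a + d + INR k) / (n + a)) * (X * Y)) by (field; auto).
unfold Cdiv at 1; rewrite Cinv_mult.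
replace (/ ((n + a + d + INR k) / (n + a)))
  with ((n + a) / (n + a + d + INR k)) by (field; auto).
replace (a + (INR k + f)) with (a + f + INR k) by ring.
set (U := rising a _); set (V := rising b _); set (W := / (X * Y)).
unfold Cdiv; rewrite (Cinv_mult a); fold W; ring.
Qed.

(** * The certificate recurrences and their sums *)

(** After division by F, both sides are rational functions of the parameters
    and of [k], and the identity is a polynomial one. *)
Lemma recurrence_n (b c d e f n a : C) (k : nat) :
  F_regular b c d e f n k a ->
  p1 b c d e f n a * F b c d e f (n + 1) k a
  + p2 b c d e f n a * F b c d e f n k a
  = G1 b c d e f n (S k) a - G1 b c d e f n k a.
Proof.
intros regular.
destruct (F_regular_neq0 _ _ _ _ _ _ _ _ regular) as (_ & _ & _ & HC & HD).
unfold G1; rewrite F_succ_k, F_succ_n by exact regular.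
unfold cert1, p1, p2, s, cA, cB, cC, cD; rewrite C_INR_S.
field; auto.
Qed.

Lemma recurrence_a (b c d e f n a : C) (k : nat) :
  F_regular b c d e f n k a ->
  p3 b c d e f n a * F b c d e f n k (a + 1)
  + p4 b c d e f n a * F b c d e f n k a
  = G2 b c d e f n (S k) a - G2 b c d e f n k a.
Proof.
intros regular.
destruct (F_regular_neq0 _ _ _ _ _ _ _ _ regular) as (_ & Ha & _ & HC & HD).
unfold G2; rewrite F_succ_k, F_succ_a by exact regular.
unfold cert2, p3, p4; rewrite C_INR_S.
field; auto.
Qed.

(** The left-hand sides sum to the combination of the two series, the right-hand
    sides telescope to [- G 0] because [G] vanishes at infinity. *)
Lemma telescoped_relation (x y G : nat -> C) (p q : C) :
  ex_series (V := C_NormedModule) x -> ex_series (V := C_NormedModule) y ->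
  (forall k, p * x k + q * y k = G (S k) - G k) -> is_Clim_seq G 0 ->
  p * CSeries x + q * CSeries y = - G O.
Proof.
intros Hx%CSeries_correct Hy%CSeries_correct HG HG0.
set (Sx := sum_n (G := C_NormedModule) x).
set (Sy := sum_n (G := C_NormedModule) y).
apply (is_Clim_seq_unique (fun m => p * Sx m + q * Sy m)).
- apply is_Clim_seq_plus;
    (apply is_Clim_seq_mult; [apply is_Clim_seq_const | assumption]).
- apply (is_Clim_seq_ext_loc (fun m => G (m + 1)%nat + - G O)).
  + exists O; intros m _; unfold Sx, Sy; rewrite Nat.add_1_r; symmetry.
    induction m as [|m IH].
    * rewrite !sum_O; exact (HG O).
    * rewrite !sum_Sn; change plus with Cplus.
      transitivity (p * Sx m + q * Sy m + (p * x (S m) + q * y (S m)));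
        [unfold Sx, Sy; ring|].
      unfold Sx, Sy; rewrite IH, HG; ring.
  + rewrite <- (Cplus_0_l (- G O)) at 1.
    apply is_Clim_seq_plus; [|apply is_Clim_seq_const].
    now apply (is_Clim_seq_incr_n G 1).
Qed.

Lemma F_sum_rec_n (b c d e f n a : C) :
  (forall k, F_regular b c d e f n k a) -> p2 b c d e f n a <> 0 ->
  ex_series (V := C_NormedModule) (fun k => F b c d e f n k a) ->
  ex_series (V := C_NormedModule) (fun k => F b c d e f (n + 1) k a) ->
  is_Clim_seq (fun k => G1 b c d e f n k a) 0 ->
  F_sum b c d e f n a
  = g1 b c d e f n a + g2 b c d e f n a * F_sum b c d e f (n + 1) a.
Proof.
intros Hreg Hp2 Hs Hs1 HG.
assert (H := telescoped_relation _ _ _ (p1 b c d e f n a) (p2 b c d e f n a)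
               Hs1 Hs (fun k => recurrence_n b c d e f n a k (Hreg k)) HG).
unfold g1, g2, F_sum in *.
set (X := CSeries (fun k => F b c d e f n k a)) in *.
transitivity (- G1 b c d e f n 0 a / p2 b c d e f n a
              - p1 b c d e f n a / p2 b c d e f n a
                * CSeries (fun k => F b c d e f (n + 1) k a));
  [rewrite <- H|]; field; exact Hp2.
Qed.

Lemma F_sum_rec_a (b c d e f n a : C) :
  (forall k, F_regular b c d e f n k a) -> p4 b c d e f n a <> 0 ->
  ex_series (V := C_NormedModule) (fun k => F b c d e f n k a) ->
  ex_series (V := C_NormedModule) (fun k => F b c d e f n k (a + 1)) ->
  is_Clim_seq (fun k => G2 b c d e f n k a) 0 ->
  F_sum b c d e f n a
  = g3 b c d e f n a + g4 b c d e f n a * F_sum b c d e f n (a + 1).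
Proof.
intros Hreg Hp4 Hs Hs1 HG.
assert (H := telescoped_relation _ _ _ (p3 b c d e f n a) (p4 b c d e f n a)
               Hs1 Hs (fun k => recurrence_a b c d e f n a k (Hreg k)) HG).
unfold g3, g4, F_sum in *.
set (X := CSeries (fun k => F b c d e f n k a)) in *.
transitivity (- G2 b c d e f n 0 a / p4 b c d e f n a
              - p3 b c d e f n a / p4 b c d e f n a
                * CSeries (fun k => F b c d e f n k (a + 1)));
  [rewrite <- H|]; field; exact Hp4.
Qed.

(** * Iteration along the diagonal *)

(** Unfolding x j = u j + v j x (j+1) repeatedly from [x 0], the partial sum
    up to [m] misses [x 0] by exactly v 0 ... v m x (m+1). *)
Lemma is_series_of_iteration (x u v : nat -> C) :
  (forall j, x j = u j + v j * x (S j)) ->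
  is_Clim_seq (fun m => Cprod (S m) v * x (S m)) 0 ->
  is_series (V := C_NormedModule) (fun j => Cprod j v * u j) (x O).
Proof.
intros Hx Hrem.
assert (Hsum : forall m,
  x O + - (1) * (Cprod (S m) v * x (S m))
  = sum_n (G := C_NormedModule) (fun j => Cprod j v * u j) m).
{ induction m as [|m IH].
  - rewrite sum_O, (Hx O); cbn; ring.
  - rewrite sum_Sn, <- IH, (Hx (S m)); change plus with Cplus; cbn; ring. }
assert (Hlim : is_Clim_seq
  (fun m => x O + - (1) * (Cprod (S m) v * x (S m))) (x O + - (1) * 0)).
{ apply is_Clim_seq_plus; [apply is_Clim_seq_const|].
  apply is_Clim_seq_mult; [apply is_Clim_seq_const | exact Hrem]. }
replace (x O + - (1) * 0) with (x O) in Hlim by ring.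
refine (is_Clim_seq_ext_loc _ _ _ _ Hlim).
exists O; intros m _; apply Hsum.
Qed.

Theorem theorem1 (a b c d e f n : C)
  (regular : forall j k : nat,
     F_regular b c d e f (n + INR j) k (a + INR j) /\
     F_regular b c d e f (n + INR j + 1) k (a + INR j))
  (p2_neq0 : forall j : nat, p2 b c d e f (n + INR j) (a + INR j) <> 0)
  (p4_neq0 : forall j : nat, p4 b c d e f (n + INR j + 1) (a + INR j) <> 0)
  (summable : forall j : nat,
     ex_series (V := C_NormedModule)
       (fun k => F b c d e f (n + INR j) k (a + INR j)) /\
     ex_series (V := C_NormedModule)
       (fun k => F b c d e f (n + INR j + 1) k (a + INR j)))
  (limG1 : forall j : nat,
     is_Clim_seq (fun k => G1 b c d e f (n + INR j) k (a + INR j)) 0)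
  (limG2 : forall j : nat,
     is_Clim_seq (fun k => G2 b c d e f (n + INR j + 1) k (a + INR j)) 0)
  (lim_remainder :
     is_Clim_seq
       (fun m => Cprod (S m) (fun i => g6 b c d e f (n + INR i) (a + INR i))
                 * F_sum b c d e f (n + INR m + 1) (a + INR m + 1)) 0) :
  is_series (V := C_NormedModule)
    (fun j => Cprod j (fun i => g6 b c d e f (n + INR i) (a + INR i))
              * g5 b c d e f (n + INR j) (a + INR j))
    (F_sum b c d e f n a).
Proof.
set (x := fun j : nat => F_sum b c d e f (n + INR j) (a + INR j)).
assert (Hshift : forall z (j : nat), z + INR (S j) = z + INR j + 1)
  by (intros z j; rewrite C_INR_S; ring).
replace (F_sum b c d e f n a) with (x O)
  by (unfold x; cbn [INR]; now rewrite !Cplus_0_r).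
apply is_series_of_iteration.
- intros j; unfold x, g5, g6; rewrite !Hshift.
  destruct (summable j) as [Hs Hs1]; destruct (summable (S j)) as [Hs2 _].
  rewrite !Hshift in Hs2.
  rewrite (F_sum_rec_n b c d e f (n + INR j) (a + INR j)
             (fun k => proj1 (regular j k)) (p2_neq0 j) Hs Hs1 (limG1 j)).
  rewrite (F_sum_rec_a b c d e f (n + INR j + 1) (a + INR j)
             (fun k => proj2 (regular j k)) (p4_neq0 j) Hs1 Hs2 (limG2 j)).
  ring.
- refine (is_Clim_seq_ext_loc _ _ _ _ lim_remainder).
  exists O; intros m _; unfold x; now rewrite !Hshift.
Qed.
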